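(* Let the total losses $Z_n$ ($n\ge 1$) have common distribution function $W\in\mathcal{R}_{-\alpha}$ for some $\alpha>0$. Suppose that $1+I_n>0$ for all $n$ and that, for every initial state $I_0=i_s$, the moment of order $\alpha$ of the discount factor, $\operatorname{E}\big((1+I_1)^{-\alpha}\,\big|\,I_0=i_s\big)$, is finite and positive. Then, for proportional reinsurance with retention level $b$, for every initial state $i_s$ and every $n\in\{1,2,\dots\}$, $$\Psi_n^b(u,i_s)\sim c_n(i_s)\,\overline{V}(u)\qquad\text{as } u\to\infty,$$ i.e. $\lim_{u\to\infty}\Psi_n^b(u,i_s)/\big(c_n(i_s)\overline{V}(u)\big)=1$, where $\overline{V}=1-V$ is the tail of the distribution function $V$ of the retained loss $bZ_1$, and the constants $c_n(i_s)$ are given recursively, for $n=1,2,\dots$, by $$c_n(i_s)=\operatorname{E}\left(\big(1+c_{n-1}(I_1)\big)\left(\frac{1}{1+I_1}\right)^{\alpha}\,\Big|\,I_0=i_s\right),$$ with the initial condition $c_0(i_s)=0$ for every state $i_s$.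
   Context: Model (discrete-time risk process with investment and proportional reinsurance): - $Z_1,Z_2,\dots$ are i.i.d. nonnegative random variables with distribution function $W$ and finite mean $\mu=\operatorname{E}Z_1$; $Z_n$ is the total loss in the period $(n-1,n]$. - The interest rates $\{I_n\}_{n\ge 0}$ form a time-homogeneous Markov chain with finite state space $\{i_1,\dots,i_l\}$ and transition probabilities $p_{st}=\Pr(I_{n+1}=i_t\mid I_n=i_s)$. The sequences $\{Z_n\}$ and $\{I_n\}$ are independent. - Proportional reinsurance with retention level $b\in(0,1]$: the insurer pays $bZ_n$ of the loss $Z_n$. The distribution function of $bZ_n$ is denoted $V$, so $V(x)=W(x/b)$. - The insurer's premium loading is $\theta>0$ and the reinsurer's is $\eta\ge\theta$; the premium retained by the insurer per period is $c(b)=\big((1+\eta)b-(\eta-\theta)\big)\mu$. It is assumed that $\operatorname{E}(bZ_1)=b\mu<c(b)$. - The insurer's surplus process is $U_0^b=u\ge 0$ and $U_n^b=U_{n-1}^b(1+I_n)+c(b)-bZ_n$ for $n\ge 1$. - The finite-time ruin probability is $\Psi_n^b(u,i_s)=\Pr\big(U_i^b<0\text{ for some }1\le i\le n\,\big|\,U_0^b=u,\ I_0=i_s\big)$. Regular variation: a distribution $F$ on $(-\infty,\infty)$ with tail $\overline{F}=1-F$ belongs to $\mathcal{R}_{-\alpha}$ ($\alpha\ge 0$) if $\lim_{x\to\infty}\overline{F}(xy)/\overline{F}(x)=y^{-\alpha}$ for every $y>0$. *)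

(* Defs.v *)
From HB Require Import structures.
From mathcomp Require Import all_boot all_order all_algebra finmap.
From mathcomp Require Import all_classical all_reals all_analysis.

Set Implicit Arguments.
Unset Strict Implicit.
Unset Printing Implicit Defensive.

Import Order.TTheory GRing.Theory Num.Theory.
Import numFieldNormedType.Exports.

Local Open Scope classical_set_scope.
Local Open Scope ring_scope.

Definition cond_prob {R : realType} {d : measure_display}
    {T : measurableType d} (P : probability T R) (A B : set T) : R :=
  fine (P (A `&` B)) / fine (P B).

(* E(X | B) for an event B with P B > 0; kept in \bar R so that its finiteness
   is a genuine assertion. *)
Definition cond_expectation {R : realType} {d : measure_display}
    {T : measurableType d} (P : probability T R) (X : T -> R) (B : set T)
    : \bar R :=
  ((\int[P]_(w in B) (X w)%:E) * ((fine (P B))^-1)%:E)%E.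

Definition mutually_independent {R : realType} {d : measure_display}
    {T : measurableType d} (P : probability T R)
    (X : nat -> {RV P >-> R}) : Prop :=
  forall (J : {fset nat}) (B : nat -> set R),
    (forall n, measurable (B n)) ->
    fine (P (\bigcap_(n in [set` J]) X n @^-1` B n)) =
    \prod_(n <- J) fine (P (X n @^-1` B n)).

Definition sigma_of_sequence {R : realType} {d : measure_display}
    {T : measurableType d} (P : probability T R)
    (X : nat -> {RV P >-> R}) : set (set T) :=
  <<s \bigcup_n preimage_set_system setT (X n) measurable >>.

Definition independent_sequences {R : realType} {d : measure_display}
    {T : measurableType d} (P : probability T R)
    (X Y : nat -> {RV P >-> R}) : Prop :=
  forall A B : set T, sigma_of_sequence X A -> sigma_of_sequence Y B ->
    P (A `&` B) = (P A * P B)%E.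

(* The state space is {i_ s | s < l}; the conditional law of I_(n+1) is only
   constrained given histories of positive probability. *)
Definition markov_chain {R : realType} {d : measure_display}
    {T : measurableType d} (P : probability T R) (l : nat) (i_ : 'I_l -> R)
    (p : 'M[R]_l) (I : nat -> {RV P >-> R}) : Prop :=
  (forall n w, exists s, I n w = i_ s) /\
  forall (n : nat) (x : nat -> 'I_l) (t : 'I_l),
    let past := [set w | forall k, (k <= n)%N -> I k w = i_ (x k)] in
    (0 < P past)%E ->
    cond_prob P [set w | I n.+1 w = i_ t] past = p (x n) t.

(* F represents a distribution function.  If its tail vanishes at some point
   then, as r / 0 = 0, the limit below is 0 and F is not regularly varying. *)
Definition regularly_varying {R : realType} (alpha : R) (F : R -> R) : Prop :=
  forall y : R, 0 < y ->
    (1 - F (x * y)) / (1 - F x) @[x --> +oo] --> y `^ (- alpha).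

Definition premium {R : realType} (theta eta mu b : R) : R :=
  ((1 + eta) * b - (eta - theta)) * mu.

Fixpoint surplus {R : realType} {T : Type} (Z I : nat -> T -> R) (b c u : R)
    (n : nat) (w : T) : R :=
  if n is m.+1 then surplus Z I b c u m w * (1 + I n w) + c - b * Z n w
  else u.

Definition ruin_prob {R : realType} {d : measure_display}
    {T : measurableType d} (P : probability T R) (Z I : nat -> {RV P >-> R})
    (b c : R) (n : nat) (u x : R) : R :=
  cond_prob P
    [set w | exists2 k : nat, (1 <= k <= n)%N & surplus Z I b c u k w < 0]
    [set w | I 0 w = x].

(* Meaningful at the states x with P(I_0 = x) > 0. *)
Fixpoint ruin_const {R : realType} {d : measure_display}
    {T : measurableType d} (P : probability T R) (I : nat -> {RV P >-> R})
    (alpha : R) (n : nat) (x : R) : R :=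
  if n is m.+1 then
    fine (cond_expectation P
      (fun w => (1 + ruin_const I alpha m (I 1 w)) *
                (1 / (1 + I 1 w)) `^ alpha)
      [set w | I 0 w = x])
  else 0.

(* Main.v *)
(** Given the path of the interest rates, dividing the surplus by the accumulated
    interest turns ruin before time [n] into the event that a partial sum of
    [(Z_j - c / b) * a_j], with [a_j] the discount factors, exceeds [u / b].
    Up to events of order [o(P (Z > u))] this means that a single [a_j * Z_j]
    exceeds [u / b]: from below by Bonferroni's inequality, from above because a
    sum exceeding [v] with no term above [(1 - e) v] has two terms above
    [e v / n].  Regular variation then gives the factor
    [\sum_j a_j ^ alpha] for each path, and averaging over the paths of the
    chain yields the recursion defining [c_n]. *)

Require Import Defs.
From HB Require Import structures.
From mathcomp Require Import all_boot all_order all_algebra finmap.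
From mathcomp Require Import all_classical all_reals all_analysis measurable_realfun.
From mathcomp Require Import lra ring.

Import Order.TTheory GRing.Theory Num.Theory.
Import numFieldNormedType.Exports.

Local Open Scope classical_set_scope.
Local Open Scope ring_scope.

(** * The single-big-jump dichotomy for finite sums *)

(** Look at a maximal term [y j0]. If it is at most [(1 - e) * v] and every other term is at most
    [t = e * v / n], the sum is at most [(1 - e) * v + n * t = v], a contradiction. So another term
    exceeds [t], and then so does the maximum. *)
Lemma one_large_or_two_moderate (R : realType) (n : nat) (y : nat -> R)
    (v e : R) :
  0 < e -> 0 < v -> v < \sum_(j < n) y j ->
  (exists2 j : 'I_n, true & (1 - e) * v < y j) \/
  (exists j : 'I_n, exists2 i : 'I_j, e * v / n%:R < y i &
     e * v / n%:R < y j).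
Proof.
case: n => [|n] e0 v0; first by rewrite big_ord0 => /(lt_trans v0); rewrite ltxx.
move=> vS; set t := e * v / _.
have t0 : 0 < t by rewrite /t divr_gt0 // mulr_gt0.
have /existsP[j0 /forallP jmax] : [exists j : 'I_n.+1, [forall i : 'I_n.+1, y i <= y j]].
  case: (@arg_maxP _ _ _ (ord0 : 'I_n.+1) xpredT y isT) => j _ h.
  by apply/existsP; exists j; apply/forallP => i; exact: h.
have [big|small] := ltP ((1 - e) * v) (y j0); first by left; exists j0.
right; have [/existsP[i /andP[ij ti]]|] :=
    boolP [exists i : 'I_n.+1, (i != j0) && (t < y i)].
  have tj : t < y j0 by exact: lt_le_trans ti (jmax i).
  have [lij|lji|eij] := ltngtP i j0.
  - by exists j0, (Ordinal lij).
  - by exists i, (Ordinal lji).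
  - by move: ij; rewrite (val_inj eij) eqxx.
rewrite negb_exists => /forallP small'.
have : \sum_(j < n.+1) y j <= (1 - e) * v + n.+1%:R * t.
  rewrite (bigD1 j0) //= lerD //.
  apply: (@le_trans _ _ (\sum_(i < n.+1 | i != j0) t)).
    apply: ler_sum => i ij; move: (small' i); rewrite ij /= -leNgt //.
  rewrite sumr_const -[leLHS]mulr_natl.
  apply: ler_wpM2r; first exact: ltW.
  by rewrite ler_nat -[leqRHS](card_ord n.+1) max_card.
rewrite [_ * t]mulrC divfK ?pnatr_eq0 // => /(lt_le_trans vS).
by rewrite mulrBl mul1r subrK ltxx.
Qed.

(** * Union bounds for real-valued probabilities *)

Section probability_of_unions.
Context {R : realType} {d : measure_display} {T : measurableType d}.
Variable P : probability T R.
Local Notation pr A := (fine (P A)).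

Lemma prU (A B : set T) : measurable A -> measurable B ->
  pr (A `|` B) = pr A + pr B - pr (A `&` B).
Proof.
move=> mA mB; rewrite measureUfinl // ?ltey_eq ?fin_num_measure //.
rewrite fineB ?fineD ?fin_numD ?fin_num_measure //; exact: measurableI.
Qed.

Lemma le_pr (A B : set T) : measurable A -> measurable B -> A `<=` B ->
  pr A <= pr B.
Proof.
move=> mA mB AB; apply: fine_le; rewrite ?fin_num_measure //.
by apply: le_measure; rewrite ?inE.
Qed.

Lemma pr_bigsetU_le (A : nat -> set T) n : (forall i, measurable (A i)) ->
  pr (\big[setU/set0]_(i < n) A i) <= \sum_(i < n) pr (A i).
Proof.
move=> mA; elim: n => [|n ih]; first by rewrite !big_ord0 measure0.
have mU : measurable (\big[setU/set0]_(i < n) A i) by exact: bigsetU_measurable.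
rewrite !big_ord_recr /= prU // lerBlDr.
by rewrite -[leLHS]addr0 lerD // ?lerD // fine_ge0.
Qed.

(** Induction on [n]: adding [A n] loses only its overlap with the earlier union, which the union
    bound controls by the pairwise intersections. *)
Lemma bonferroni (A : nat -> set T) n : (forall i, measurable (A i)) ->
  \sum_(i < n) pr (A i) - \sum_(j < n) \sum_(i < j) pr (A i `&` A j) <=
  pr (\big[setU/set0]_(i < n) A i).
Proof.
move=> mA; elim: n => [|n ih]; first by rewrite !big_ord0 measure0 subr0.
have mU : measurable (\big[setU/set0]_(i < n) A i) by exact: bigsetU_measurable.
rewrite !big_ord_recr /= prU //.
have : pr (\big[setU/set0]_(i < n) A i `&` A n) <=
    \sum_(i < n) pr (A i `&` A n).
  rewrite big_distrl /=; apply: (pr_bigsetU_le (fun i => A i `&` A n)) => i.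
  exact: measurableI.
move: ih; lra.
Qed.

End probability_of_unions.

(** * Auxiliary limits and measurability *)

Lemma cvg_sum_seq {R : realType} (S : Type) (F : set_system S) (FF : Filter F)
    (J : Type) (r : seq J) (f : J -> S -> R) (a : J -> R) :
  (forall i, f i x @[x --> F] --> a i) ->
  (\sum_(i <- r) f i x) @[x --> F] --> \sum_(i <- r) a i.
Proof.
move=> fa; elim: r => [|j r ih].
  rewrite big_nil; under eq_fun do rewrite big_nil; exact: cvg_cst.
rewrite big_cons; under eq_fun do rewrite big_cons; exact: cvgD.
Qed.

(** The sigma-algebra is arbitrary so that the lemma also applies to the one generated by the
    losses, as independence from the rates requires. *)
Lemma exists_lt_measurable (R : realType) (d : measure_display)
    (T : measurableType d) (g : nat -> T -> R) (n : nat) (v : R) :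
  (forall k, measurable_fun setT (g k)) ->
  measurable [set w | exists2 k, (k < n)%N & v < g k w].
Proof.
move=> mg.
have -> : [set w | exists2 k, (k < n)%N & v < g k w] =
    \bigcup_k (if (k < n)%N then g k @^-1` `]v, +oo[ else set0).
  apply/seteqP; split => w /=.
    by case=> k kn vk; exists k => //; rewrite kn /= in_itv /= vk.
  by case=> k _; case: ifP => //= kn; rewrite in_itv /= andbT => vk; exists k.
apply: bigcup_measurable => k _; case: ifP => // _.
by rewrite -[X in measurable X]setTI; exact: mg.
Qed.

Lemma powR_continuousl (R : realType) (a x : R) :
  0 < x -> {for x, continuous (fun y : R => y `^ a)}.
Proof.
move=> x0; apply/differentiable_continuous/derivable1_diffP.
by have [] := is_derive1_powR a x0.
Qed.

(** * Tail asymptotics of weighted sums with fixed positive weights *)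

Section weighted_sums.
Context {R : realType} {d : measure_display} {T : measurableType d}.
Variables (P : probability T R) (X : nat -> {RV P >-> R}) (G : R -> R).
Variables (alpha c : R) (a : nat -> R) (n : nat).
Local Notation pr A := (fine (P A)).

Hypothesis X_ge0 : forall j w, 0 <= X j w.
Hypothesis X_tail : forall j x, pr [set w | x < X j w] = G x.
Hypothesis X_pair : forall i j x y, (i < j)%N ->
  pr ([set w | x < X i w] `&` [set w | y < X j w]) = G x * G y.
Hypothesis G_cvg0 : G x @[x --> +oo] --> (0 : R).
Hypothesis G_rv : forall y, 0 < y -> G (x * y) / G x @[x --> +oo] --> y `^ (- alpha).
Hypothesis a_gt0 : forall j, 0 < a j.
Hypothesis c_ge0 : 0 <= c.

(** Ruin by time [n] in discounted form along a fixed path of rates; index [k] stands for time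
    [k + 1]. *)
Definition exceedance (v : R) : set T :=
  [set w | exists2 k, (k < n)%N & v < \sum_(j < k.+1) (X j w - c) * a j].

(** [G (v * (x / a j))] is the probability that [X j * a j] exceeds [x * v], written with [v] times
    a constant to match [G_rv]. So [one] and [two] are the single and pairwise sums of Bonferroni's
    inequality. *)
Let one (x v : R) := \sum_(j < n) G (v * (x / a j)).
Let two (x v : R) := \sum_(j < n) \sum_(i < j) G (v * (x / a i)) * G (v * (x / a j)).

Let mX j x : measurable [set w | x < X j w].
Proof. by rewrite -preimage_itvoy; exact: measurable_funPTI. Qed.

Lemma exceedance_measurable v : measurable (exceedance v).
Proof.
apply: (@exists_lt_measurable _ _ _ (fun k w => \sum_(j < k.+1) (X j w - c) * a j)).
move=> k; apply: measurable_sum => j.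
apply: measurable_funM => //.
exact: measurable_funB.
Qed.

Let A x v j := [set w | v * (x / a j) < X j w].

Let A_E x v j w : A x v j w = (x * v < X j w * a j) :> Prop.
Proof. by rewrite /A /= mulrA ltr_pdivrMr // [v * x]mulrC. Qed.

Let mA x v j : measurable (A x v j). Proof. exact: mX. Qed.

Let oneE x v : one x v = \sum_(j < n) pr (A x v j).
Proof. by apply: eq_bigr => j _; rewrite X_tail. Qed.

Let twoE x v : two x v = \sum_(j < n) \sum_(i < j) pr (A x v i `&` A x v j).
Proof. by apply: eq_bigr => j _; apply: eq_bigr => i _; rewrite X_pair. Qed.

(** If [X j * a j] exceeds [(1 + e) * v], the partial sum up to [j] exceeds [v]: the other losses
    are nonnegative, and all premiums together cost at most [e * v]. Bonferroni's inequality then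
    applies. *)
Lemma exceedance_lower e v : 0 < e -> 0 < v ->
  c * (\sum_(j < n) a j) <= e * v ->
  one (1 + e) v - two (1 + e) v <= pr (exceedance v).
Proof.
move=> e0 v0 cv; rewrite oneE twoE.
apply: le_trans (bonferroni P _ _ (mA _ _)) _; apply: le_pr.
- exact: bigsetU_measurable.
- exact: exceedance_measurable.
rewrite -(bigcup_mkord n (A (1 + e) v)) => w [j /= jn]; rewrite A_E => big.
exists j => //; apply: (@lt_le_trans _ _ (X j w * a j - c * \sum_(i < n) a i)).
  by move: big cv; rewrite mulrDl mul1r; lra.
have -> : \sum_(i < j.+1) (X i w - c) * a i =
    \sum_(i < j.+1) X i w * a i - c * \sum_(i < j.+1) a i.
  by rewrite mulr_sumr -sumrB; apply: eq_bigr => i _; rewrite mulrBl.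
rewrite lerB //.
  rewrite big_ord_recr /= lerDr sumr_ge0 // => i _.
  by rewrite mulr_ge0 // ltW.
rewrite ler_wpM2l //.
rewrite -(big_mkord xpredT a) -(big_mkord xpredT a).
rewrite [leRHS](big_cat_nat (n := j.+1)) //=.
by rewrite lerDl sumr_ge0 // => i _; rewrite ltW.
Qed.

(** Dropping the premiums and adding the remaining nonnegative losses only enlarges the sum, so the
    full loss sum exceeds [v]. The dichotomy and the union bound finish. *)
Lemma exceedance_upper e v : 0 < e -> 0 < v ->
  pr (exceedance v) <= one (1 - e) v + two (e / n%:R) v.
Proof.
move=> e0 v0; rewrite oneE twoE.
set A1 := A (1 - e) v; set A2 := A (e / n%:R) v.
pose B j := \big[setU/set0]_(i < j) (A2 i `&` A2 j).
have mA2 i j : measurable (A2 i `&` A2 j) by apply: measurableI; exact: mA.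
have mB j : measurable (B j) by exact: bigsetU_measurable.
have mU1 : measurable (\big[setU/set0]_(j < n) A1 j).
  by apply: bigsetU_measurable => i _; exact: mA.
have mU2 : measurable (\big[setU/set0]_(j < n) B j) by exact: bigsetU_measurable.
apply: (@le_trans _ _ (pr (\big[setU/set0]_(j < n) A1 j `|` \big[setU/set0]_(j < n) B j))).
  apply: le_pr; [exact: exceedance_measurable|exact: measurableU|].
  move=> w [k kn vk].
  have : v < \sum_(j < n) X j w * a j.
    apply: (lt_le_trans vk); apply: (@le_trans _ _ (\sum_(j < k.+1) X j w * a j)).
      apply: ler_sum => j _; apply: ler_wpM2r; first exact: ltW.
      by rewrite gerBl.
    pose f j := X j w * a j.
    rewrite -(big_mkord xpredT f) -(big_mkord xpredT f).
    rewrite [leRHS](big_cat_nat (n := k.+1)) //= lerDl.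
    by apply: sumr_ge0 => i _; rewrite mulr_ge0 // ltW.
  case/(@one_large_or_two_moderate _ _ (fun j => X j w * a j) _ _ e0 v0).
    case=> j _ h; left; rewrite -(bigcup_mkord n A1); exists j => //=.
    by rewrite /A1 A_E.
  case=> j [i hi hj]; right; rewrite -(bigcup_mkord n B); exists j => //=.
  rewrite /B -(bigcup_mkord j (fun i => A2 i `&` A2 j)); exists i => //=.
  by split; rewrite /A2 A_E mulrAC.
rewrite prU // lerBlDr -[leLHS]addr0 lerD ?fine_ge0 // lerD //.
  by apply: pr_bigsetU_le => i; exact: mA.
apply: le_trans (pr_bigsetU_le _ _ _ mB) _; apply: ler_sum => j _.
exact: (pr_bigsetU_le _ (fun i => A2 i `&` A2 j)).
Qed.

Let scale_cvgy (x : R) : 0 < x -> v * x @[v --> +oo] --> +oo.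
Proof. by move=> x0; apply: gt0_cvgMly. Qed.

Let S := \sum_(j < n) a j `^ alpha.

(** Regular variation with [y = x / a j], whose power [- alpha] splits as
    [x ^ (- alpha) * a j ^ alpha]. *)
Let one_cvg x : 0 < x -> one x v / G v @[v --> +oo] --> x `^ (- alpha) * S.
Proof.
move=> x0; rewrite /S mulr_sumr; under eq_fun do rewrite /one mulr_suml.
apply: (@cvg_sum_seq _ _ _ _ _ _ (fun (j : 'I_n) v => G (v * (x / a j)) / G v)
  (fun j => x `^ (- alpha) * a j `^ alpha)) => j.
have -> : x `^ (- alpha) * a j `^ alpha = (x / a j) `^ (- alpha).
  rewrite powRM ?invr_ge0 ?ltW // -[X in _ = _ * X `^ _]powR_inv1 ?ltW //.
  by rewrite -powRrM mulN1r opprK.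
by apply: G_rv; rewrite divr_gt0.
Qed.

(** In each product one factor tends to 0, while the other divided by [G v] has a finite limit by
    regular variation. *)
Let two_cvg x : 0 < x -> two x v / G v @[v --> +oo] --> (0 : R).
Proof.
have cvg_sum0 m (f : 'I_m -> R -> R) : (forall i, f i v @[v --> +oo] --> (0 : R)) ->
    \sum_i f i v @[v --> +oo] --> (0 : R).
  move=> /(cvg_sum_seq _ _ _ _ (index_enum 'I_m) f (fun=> 0)).
  by rewrite sumr_const mul0rn.
move=> x0; under eq_fun do rewrite /two mulr_suml.
apply: (cvg_sum0 _ (fun j v =>
  (\sum_(i < j) G (v * (x / a i)) * G (v * (x / a j))) / G v)) => j.
under eq_fun do rewrite mulr_suml.
apply: (cvg_sum0 _ (fun i v => G (v * (x / a i)) * G (v * (x / a j)) / G v)) => i.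
under eq_fun do rewrite -mulrA.
have h : G (v * (x / a i)) @[v --> +oo] --> (0 : R).
  by apply: cvg_comp G_cvg0; apply: scale_cvgy; rewrite divr_gt0.
have xj : 0 < x / a j by rewrite divr_gt0.
have hk := cvgM h (G_rv _ xj); rewrite mul0r in hk; exact: hk.
Qed.

(** For fixed [e] the two bounds divided by [G v] tend to [(1 + e) ^ (- alpha) * S] and
    [(1 - e) ^ (- alpha) * S]; continuity of the power at 1 makes both as close to [S] as
    desired. *)
Lemma exceedance_cvg : pr (exceedance v) / G v @[v --> +oo] --> S.
Proof.
(* Nonnegativity of the inverse is enough to divide the bounds; it also covers [G v = 0], where the
   inverse is 0 by convention. *)
have G0 v : 0 <= (G v)^-1 by rewrite invr_ge0 -(X_tail 0%N) fine_ge0.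
have cont : x `^ (- alpha) * S @[x --> (1 : R)] --> S.
  have h := cvgM (powR_continuousl R (- alpha) 1 ltr01) (cvg_cst S).
  by rewrite powR1 mul1r in h; exact: h.
have near1 (U : set R) : nbhs S U -> exists2 e, 0 < e < 1 &
    U ((1 - e) `^ (- alpha) * S) /\ U ((1 + e) `^ (- alpha) * S).
  move=> /cont /nbhs_ballP[r /= r0 rU].
  (* Less than [r], to keep [1 - e] and [1 + e] in the ball, and less than 1, to keep [1 - e]
     positive. *)
  exists (Num.min r 1 / 2); first by rewrite divr_gt0 ?lt_min ?r0 //=
    ltr_pdivrMr // mul1r gt_min ltr1n orbT.
  have rr : 0 < Num.min r 1 / 2 < r.
    rewrite divr_gt0 ?lt_min ?r0 //= ltr_pdivrMr // gt_min.
    by apply/orP; left; move: r0; lra.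
  move: rr => /andP[p q].
  split; apply: rU; rewrite /ball /=.
    by rewrite opprB addrC subrK gtr0_norm.
  by rewrite opprD addrA subrr sub0r normrN gtr0_norm.
apply/cvgrPdist_le => eps eps0.
have [e /andP[e0 e1] [ub lb]] := near1 (ball S eps) (nbhsx_ballx _ _ eps0).
have e1' : 0 < 1 + e by rewrite addr_gt0.
move: ub lb; rewrite /ball /= !ltr_norml => /andP[ub _] /andP[_ lb].
have up : \forall v \near +oo, one (1 - e) v / G v + two (e / n%:R) v / G v < S + eps.
  (* For [n = 0] the threshold [e / n] would be 0 and [two_cvg] would not apply, but all sums are
     empty. *)
  have [n0|n0] := posnP n.
    near=> v; rewrite /one /two /S; move: eps0; rewrite n0 !big_ord0 !mul0r; lra.
  have e1'' : 0 < 1 - e by rewrite subr_gt0.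
  have en0 : 0 < e / n%:R by rewrite divr_gt0 ?ltr0n.
  have h : one (1 - e) v / G v + two (e / n%:R) v / G v @[v --> +oo] -->
      (1 - e) `^ (- alpha) * S + 0.
    by apply: cvgD; [exact: one_cvg|exact: two_cvg].
  apply: (cvgr_lt _ h); rewrite addr0; move: ub; lra.
have lo : \forall v \near +oo, S - eps < one (1 + e) v / G v - two (1 + e) v / G v.
  have h : one (1 + e) v / G v - two (1 + e) v / G v @[v --> +oo] -->
      (1 + e) `^ (- alpha) * S - 0.
    by apply: cvgB; [exact: one_cvg|exact: two_cvg].
  apply: (cvgr_gt _ h); rewrite subr0; move: lb; lra.
near=> v.
have v0 : 0 < v by near: v; exact: nbhs_pinfty_gt.
have cv : c * (\sum_(j < n) a j) <= e * v.
  rewrite [leRHS]mulrC -ler_pdivrMr //; near: v; exact: nbhs_pinfty_ge.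
have hu := ler_wpM2r (G0 v) (exceedance_upper e v e0 v0).
have hl := ler_wpM2r (G0 v) (exceedance_lower e v e0 v0 cv).
have : one (1 - e) v / G v + two (e / n%:R) v / G v < S + eps by near: v.
have : S - eps < one (1 + e) v / G v - two (1 + e) v / G v by near: v.
move: hu hl; rewrite mulrDl mulrBl ler_norml => *.
by apply/andP; split; lra.
Unshelve. all: by end_near.
Qed.

End weighted_sums.

(** * Sums over state paths and the recursion for the constants *)

Section path_sums.
Context {R : realType} {l : nat}.

(** The sum of [F] over all state sequences of length [n]. Unfolding at the first state fits the
    recursion for the constants; [sum_paths_rcons] unfolds at the last state, as the Markov property
    requires. *)
Fixpoint sum_paths (n : nat) (F : seq 'I_l -> R) : R :=
  if n is m.+1 then \sum_t sum_paths m (fun q => F (t :: q)) else F [::].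

Lemma eq_sum_paths n F F' : (forall q, size q = n -> F q = F' q) ->
  sum_paths n F = sum_paths n F'.
Proof.
elim: n F F' => [|n ih] F F' FF' /=; first exact: FF'.
by apply: eq_bigr => t _; apply: ih => q qn; apply: FF'; rewrite /= qn.
Qed.

Lemma sum_paths_rcons n F :
  sum_paths n.+1 F = sum_paths n (fun q => \sum_t F (rcons q t)).
Proof.
elim: n F => [//|n ih] F.
transitivity (\sum_t sum_paths n.+1 (fun q => F (t :: q))); first by [].
by apply: eq_bigr => t _; rewrite ih.
Qed.

Lemma sum_pathsD n F F' :
  sum_paths n (fun q => F q + F' q) = sum_paths n F + sum_paths n F'.
Proof.
elim: n F F' => [//|n ih] F F' /=.
by rewrite -big_split /=; apply: eq_bigr => t _; exact: ih.
Qed.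

Lemma sum_pathsMl n x F :
  sum_paths n (fun q => x * F q) = x * sum_paths n F.
Proof.
elim: n F => [//|n ih] F /=.
by rewrite mulr_sumr; apply: eq_bigr => t _; exact: ih.
Qed.

Lemma cvg_sum_paths (S : Type) (F : set_system S) (FF : Filter F) n
    (f : S -> seq 'I_l -> R) (a : seq 'I_l -> R) :
  (forall q, size q = n -> f x q @[x --> F] --> a q) ->
  sum_paths n (f x) @[x --> F] --> sum_paths n a.
Proof.
elim: n f a => [|n ih] f a fa /=; first exact: fa.
apply: (cvg_sum_seq _ _ _ _ _ (fun t x => sum_paths n (fun q => f x (t :: q)))
  (fun t => sum_paths n (fun q => a (t :: q)))) => t.
by apply: ih => q qn; apply: fa; rewrite /= qn.
Qed.

Variable p : 'M[R]_l.

Fixpoint path_weight (s : 'I_l) (q : seq 'I_l) : R :=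
  if q is t :: q' then p s t * path_weight t q' else 1.

Lemma path_weight_rcons s q t :
  path_weight s (rcons q t) = path_weight s q * p (last s q) t.
Proof.
elim: q s => [|t' q ih] s /=; first by rewrite mul1r mulr1.
by rewrite ih mulrA.
Qed.

Variables (x : 'I_l -> R) (alpha : R).
Hypothesis x_gt0 : forall s, 0 < x s.
Hypothesis p_sum1 : forall s, \sum_t p s t = 1.
Hypothesis p_ge0 : forall s t, 0 <= p s t.

(** Horner form of the sum of the [alpha]-th powers of the discount factors along [q], see
    [discount_sumE]. *)
Fixpoint discount_sum (q : seq 'I_l) : R :=
  if q is t :: q' then (x t)^-1 `^ alpha * (1 + discount_sum q') else 0.

(** The factor for the loss at time [j + 1]. Since [q] starts at time 1, [s] serves only as the
    default of [nth] past the end of [q], which keeps every factor positive. *)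
Definition discount (s : 'I_l) (q : seq 'I_l) (j : nat) : R :=
  (\prod_(m < j.+1) x (nth s q m))^-1.

Lemma discount_gt0 s q j : 0 < discount s q j.
Proof. by rewrite invr_gt0 prodr_gt0. Qed.

Lemma discount_sumE s q :
  discount_sum q = \sum_(j < size q) discount s q j `^ alpha.
Proof.
elim: q => [|t q ih] /=; first by rewrite big_ord0.
rewrite big_ord_recl /= {1}/discount big_ord_recl big_ord0 mulr1 /= mulrDr mulr1 ih.
rewrite mulr_sumr; congr (_ + _); apply: eq_bigr => j _.
rewrite {2}/discount big_ord_recl /= invfM powRM ?invr_ge0 ?ltW //.
by rewrite prodr_gt0.
Qed.

(** The constants $c_n$ with the conditional expectation written out through the transition
    matrix. *)
Fixpoint ruin_coef (n : nat) (s : 'I_l) : R :=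
  if n is m.+1 then \sum_t p s t * ((1 + ruin_coef m t) * (x t)^-1 `^ alpha) else 0.

Lemma ruin_coef_ge0 n s : 0 <= ruin_coef n s.
Proof.
elim: n s => [//|n ih] s /=; apply: sumr_ge0 => t _.
by rewrite !mulr_ge0 ?powR_ge0 // addr_ge0.
Qed.

(** If this sum of nonnegative terms vanished, every [p s t] would be 0, as its cofactor is
    positive; but row [s] sums to 1. *)
Lemma ruin_coef_gt0 n s : (0 < n)%N -> 0 < ruin_coef n s.
Proof.
case: n => // n _; rewrite lt_def ruin_coef_ge0 andbT; apply/eqP => /= c0.
have t0 t : 0 < (1 + ruin_coef n t) * (x t)^-1 `^ alpha.
  by rewrite mulr_gt0 ?powR_gt0 ?invr_gt0 // (lt_le_trans ltr01) // lerDl ruin_coef_ge0.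
have := p_sum1 s; rewrite big1 => [/eqP|t _]; first by rewrite eq_sym oner_eq0.
apply/eqP; rewrite -(mulIr_eq0 (p s t) (mulIf (lt0r_neq0 (t0 t)))); apply/eqP.
by apply: (psumr_eq0P _ c0) => // t' _; rewrite mulr_ge0 // ltW.
Qed.

Lemma sum_path_weight n s : sum_paths n (path_weight s) = 1.
Proof.
elim: n s => [//|n ih] s /=; rewrite -[RHS](p_sum1 s); apply: eq_bigr => t _.
by rewrite sum_pathsMl ih mulr1.
Qed.

(** Split off the first step: in [1 + discount_sum q] the 1 averages to the total path weight 1, and
    the rest is the induction hypothesis. *)
Lemma sum_path_weight_discount n s :
  sum_paths n (fun q => path_weight s q * discount_sum q) = ruin_coef n s.
Proof.
elim: n s => [|n ih] s /=; first by rewrite mulr0.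
apply: eq_bigr => t _; rewrite -[X in X + ruin_coef n t](sum_path_weight n t).
rewrite -ih -sum_pathsD.
rewrite [RHS]mulrC -[RHS]mulrA [RHS]mulrC -sum_pathsMl; apply: eq_sum_paths => q _.
by ring.
Qed.

End path_sums.

(** * Path probabilities of the interest-rate chain *)

Section markov_paths.
Context {R : realType} {d : measure_display} {T : measurableType d}.
Variables (P : probability T R) (l : nat) (i_ : 'I_l -> R) (p : 'M[R]_l).
Variable (I : nat -> {RV P >-> R}).
Local Notation pr A := (fine (P A)).

(* [q] lists the states at times [1, .., size q]; the state at time [0] is [s]. *)
Definition path_event (s : 'I_l) (q : seq 'I_l) : set T :=
  [set w | forall k, (k <= size q)%N -> I k w = i_ (nth s (s :: q) k)].

Let mI n y : measurable [set w | I n w = y].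
Proof. exact: (measurable_funPTI (I n) (measurable_set1 y)). Qed.

Lemma path_event_nil s : path_event s [::] = [set w | I 0%N w = i_ s].
Proof.
by apply/seteqP; split => w /=; [exact|move=> w0 k]; rewrite leqn0 => /eqP ->.
Qed.

Lemma path_event_rcons s q t :
  path_event s (rcons q t) = [set w | I (size q).+1 w = i_ t] `&` path_event s q.
Proof.
apply/seteqP; split => w /=.
  move=> h; split; first by rewrite h /= ?size_rcons // nth_rcons ltnn eqxx.
  move=> k kq; rewrite h ?size_rcons ?(leq_trans kq) //.
  by rewrite -rcons_cons nth_rcons /= ltnS kq.
move=> [ht h] k; rewrite size_rcons leq_eqVlt => /orP[/eqP ->|].
  by rewrite /= nth_rcons ltnn eqxx.
by rewrite ltnS => kq; rewrite -rcons_cons nth_rcons /= ltnS kq h.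
Qed.

Lemma path_event_measurable s q : measurable (path_event s q).
Proof.
elim/last_ind: q => [|q t ih]; first by rewrite path_event_nil.
by rewrite path_event_rcons; exact: measurableI.
Qed.

Hypothesis i_inj : injective i_.
Hypothesis I_markov : markov_chain i_ p I.

(** Chain rule, by appending the last state and applying the Markov property to the path so far. *)
Lemma pr_path_event s q :
  pr (path_event s q) = pr [set w | I 0%N w = i_ s] * path_weight p s q.
Proof.
elim/last_ind: q => [|q t ih]; first by rewrite path_event_nil mulr1.
rewrite path_weight_rcons path_event_rcons mulrA -ih.
(* The Markov property is silent on null histories, but then the longer path is null too and both
   sides vanish. *)
have [q0|q0] := eqVneq (P (path_event s q)) 0%E.
  rewrite q0 mul0r.
  suff -> : P ([set w | I (size q).+1 w = i_ t] `&` path_event s q) = 0%E by [].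
  apply/eqP; rewrite eq_le measure_ge0 andbT -q0 le_measure // inE.
    by apply: measurableI => //; exact: path_event_measurable.
  exact: path_event_measurable.
have -> : last s q = nth s (s :: q) (size q) by rewrite (nth_last s (s :: q)).
have <- : cond_prob P [set w | I (size q).+1 w = i_ t] (path_event s q) =
    p (nth s (s :: q) (size q)) t.
  by apply: (I_markov.2 (size q) (nth s (s :: q)) t); rewrite lt0e q0 measure_ge0.
rewrite /cond_prob mulrCA divff ?mulr1 //.
by rewrite fine_eq0 ?fin_num_measure //; exact: path_event_measurable.
Qed.

(** The chain always sits in some state, and injectivity of [i_] makes the state events disjoint.
    Finite additivity is proved by induction over duplicate-free lists of states. *)
Lemma pr_split_state n (B : set T) : measurable B ->
  pr B = \sum_t pr ([set w | I n w = i_ t] `&` B).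
Proof.
move=> mB.
have split r : uniq r -> pr ([set w | exists2 t, t \in r & I n w = i_ t] `&` B) =
    \sum_(t <- r) pr ([set w | I n w = i_ t] `&` B).
  have mr r' : measurable [set w | exists2 t, t \in r' & I n w = i_ t].
    have -> : [set w | exists2 t, t \in r' & I n w = i_ t] =
        \bigcup_(t in [set` r']) [set w | I n w = i_ t].
      by apply/seteqP; split => w [t /= ? ?]; exists t.
    exact: fin_bigcup_measurable.
  elim: r => [_|t r ih /= /andP[tr ur]].
    rewrite big_nil (_ : _ `&` B = set0) ?measure0 //.
    by apply/seteqP; split => w // [[]].
  rewrite big_cons -ih //.
  have -> : [set w | exists2 t', t' \in t :: r & I n w = i_ t'] =
      [set w | I n w = i_ t] `|` [set w | exists2 t', t' \in r & I n w = i_ t'].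
    apply/seteqP; split => w /=.
      by case=> t'; rewrite inE => /orP[/eqP ->|]; [left|right; exists t'].
    by case=> [wt|[t' t'r wt]]; 
      [exists t; rewrite ?mem_head|exists t'; rewrite // inE t'r orbT].
  rewrite setIUl prU; [|exact: measurableI|exact: measurableI].
  rewrite (_ : _ `&` _ `&` _ = set0) ?measure0 ?subr0 //.
  apply/seteqP; split => w //= [[wt _] [[t' t'r wt'] _]].
  by move: tr; rewrite (i_inj _ _ (etrans (esym wt) wt')) t'r.
rewrite -split ?index_enum_uniq //; congr (fine (P _)).
apply/seteqP; split => w //=; last by case.
by move=> wB; split => //; have [t wt] := I_markov.1 n w;
  exists t; rewrite ?mem_index_enum.
Qed.

Lemma pr_split_paths n s (B : set T) : measurable B ->
  pr (B `&` [set w | I 0%N w = i_ s]) =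
  sum_paths n (fun q => pr (B `&` path_event s q)).
Proof.
move=> mB; elim: n => [|n ih]; first by rewrite /= path_event_nil.
rewrite ih sum_paths_rcons; apply: eq_sum_paths => q qn.
rewrite (pr_split_state n.+1); last first.
  by apply: measurableI => //; exact: path_event_measurable.
by apply: eq_bigr => t _; rewrite path_event_rcons qn setICA.
Qed.

Hypothesis I0_gt0 : forall s, (0 < P [set w | I 0%N w = i_ s])%E.

Lemma pr_I0_gt0 s : 0 < pr [set w | I 0%N w = i_ s].
Proof. by rewrite fine_gt0 // I0_gt0 ltey_eq fin_num_measure. Qed.

(** The Markov property at time 0. As every initial state has positive probability, it shows that
    [p] is stochastic, which [markov_chain] does not postulate. *)
Lemma transitionE s t : p s t =
  pr ([set w | I 1%N w = i_ t] `&` [set w | I 0%N w = i_ s]) /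
  pr [set w | I 0%N w = i_ s].
Proof.
rewrite -path_event_nil; symmetry; apply: (I_markov.2 0%N (nth s [:: s]) t).
by rewrite -/(path_event s [::]) path_event_nil.
Qed.

Lemma transition_ge0 s t : 0 <= p s t.
Proof. by rewrite transitionE divr_ge0 ?fine_ge0. Qed.

Lemma transition_sum1 s : \sum_t p s t = 1.
Proof.
under eq_bigr do rewrite transitionE.
by rewrite -mulr_suml -pr_split_state // divff // gt_eqF // pr_I0_gt0.
Qed.

(** [f (I 1)] is a finite combination of indicators of the state events, so it can be integrated
    term by term. *)
Lemma cond_expectation_next (f : R -> R) s : (forall t, 0 <= f (i_ t)) ->
  fine (cond_expectation P (fun w => f (I 1%N w)) [set w | I 0%N w = i_ s]) =
  \sum_t p s t * f (i_ t).
Proof.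
move=> f0; rewrite /cond_expectation.
have -> : (fun w => (f (I 1%N w))%:E) =
    (fun w => \sum_t (f (i_ t))%:E * (\1_[set w | I 1%N w = i_ t] w)%:E)%E.
  apply/funext => w; have [t wt] := I_markov.1 1%N w.
  rewrite (bigD1 t) //= big1 ?adde0 => [|t' t't].
    by rewrite wt indicE mem_set // mule1.
  rewrite indicE memNset ?mule0 //= => wt'.
  by move: t't; rewrite (i_inj _ _ (etrans (esym wt') wt)) eqxx.
rewrite ge0_integral_sum //; first last.
- by move=> t w _; rewrite -EFinM lee_fin mulr_ge0.
- move=> t; apply: emeasurable_funM => //; apply/measurable_EFinP.
  exact: measurable_indic.
rewrite (eq_bigr (fun t => (f (i_ t) *
    pr ([set w | I 1%N w = i_ t] `&` [set w | I 0%N w = i_ s]))%:E)) => [|t _].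
  rewrite sumEFin -EFinM /= mulr_suml; apply: eq_bigr => t _.
  by rewrite transitionE [RHS]mulrC mulrA.
rewrite ge0_integralZl_EFin //.
- by rewrite integral_indic // EFinM fineK // fin_num_measure //; exact: measurableI.
- by apply/measurable_EFinP; exact: measurable_indic.
Qed.

(** Each state is attained at time 0, since an event of positive probability is nonempty. *)
Lemma state_gtN1 t : (forall n w, 0 < 1 + I n w) -> 0 < 1 + i_ t.
Proof.
move=> I_gt; have := I0_gt0 t.
have [->|/set0P[w <-] _] := eqVneq [set w | I 0%N w = i_ t] set0.
  by rewrite measure0 ltxx.
exact: I_gt.
Qed.

Lemma ruin_constE alpha n s :
  (forall n w, 0 < 1 + I n w) ->
  ruin_const I alpha n (i_ s) = ruin_coef p (fun t => 1 + i_ t) alpha n s.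
Proof.
move=> I_gt; have i0 t := state_gtN1 t I_gt.
elim: n s => [//|n ih] s /=.
rewrite (cond_expectation_next (fun y =>
  (1 + ruin_const I alpha n y) * (1 / (1 + y)) `^ alpha)).
  by apply: eq_bigr => t _; rewrite ih div1r.
move=> t; rewrite ih mulr_ge0 ?powR_ge0 // addr_ge0 // ruin_coef_ge0 //.
exact: transition_ge0.
Qed.

End markov_paths.

(** * The discounted surplus and the sigma-algebras of the two sequences *)

(** Factoring out the accumulated interest leaves the initial capital minus the discounted losses
    net of premium; taking [b] out of the sum turns the premium into [c / b]. *)
Lemma surplusE (R : realType) (T : Type) (Z I : nat -> T -> R) (b c u : R)
    (k : nat) (w : T) :
  b != 0 -> (forall n w, 1 + I n w != 0) ->
  surplus Z I b c u k w = \prod_(m < k) (1 + I m.+1 w) *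
    (u - b * \sum_(j < k) (Z j.+1 w - c / b) / \prod_(m < j.+1) (1 + I m.+1 w)).
Proof.
move=> b0 I0; elim: k => [|k ih] /=; first by rewrite !big_ord0 mulr0 subr0 mul1r.
rewrite ih [\sum_(j < k.+1) _]big_ord_recr /= ![\prod_(m < k.+1) _]big_ord_recr /=.
have A0 : \prod_(m < k) (1 + I m.+1 w) != 0 by apply/prodf_neq0 => m _.
have := I0 k.+1 w; move: A0; move: (\prod_(m < k) _) (1 + I k.+1 w) (\sum_(j < k) _).
by move=> A y S A0 y0; field; rewrite A0 y0 b0.
Qed.

Lemma surplus_measurable (R : realType) (d : measure_display)
    (T : measurableType d) (P : probability T R) (Z I : nat -> {RV P >-> R})
    (b c u : R) (k : nat) :
  measurable_fun setT (surplus Z I b c u k).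
Proof.
elim: k => [|k ih] /=; first exact: measurable_cst.
apply: measurable_funB; last exact: measurable_funM.
apply: measurable_funD => //; apply: measurable_funM => //.
exact: measurable_funD.
Qed.

(** Carries the generated sigma-algebra as a measurable type: membership in [sigma_of_sequence]
    becomes measurability by conversion, and the library closure lemmas apply. *)
Definition sigma_of_sequence_type (R : realType) (d : measure_display)
    (T : measurableType d) (P : probability T R) (X : nat -> {RV P >-> R}) :=
  g_sigma_algebraType (\bigcup_n preimage_set_system setT (X n) measurable).

Lemma sequence_measurable (R : realType) (d : measure_display)
    (T : measurableType d) (P : probability T R) (X : nat -> {RV P >-> R}) n :
  measurable_fun [set: sigma_of_sequence_type _ _ _ _ X] (X n).
Proof.
by move=> _ B mB; apply: sub_sigma_algebra; exists n => //; exists B.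
Qed.

Lemma path_event_sigma (R : realType) (d : measure_display)
    (T : measurableType d) (P : probability T R) (l : nat) (i_ : 'I_l -> R)
    (I : nat -> {RV P >-> R}) s q :
  sigma_of_sequence I (path_event P l i_ I s q).
Proof.
have -> : path_event P l i_ I s q =
    \bigcap_(k in `I_(size q).+1) (I k @^-1` [set i_ (nth s (s :: q) k)]).
  by apply/seteqP; split => w h k /= kq; apply: h.
suff : measurable (\bigcap_(k in `I_(size q).+1)
    (I k @^-1` [set i_ (nth s (s :: q) k)]) : set (sigma_of_sequence_type _ _ _ _ I)) by [].
apply: bigcap_measurableType => k _; rewrite -[X in measurable X]setTI.
exact: (sequence_measurable _ _ _ _ I).
Qed.

Lemma exceedance_sigma (R : realType) (d : measure_display)
    (T : measurableType d) (P : probability T R) (X : nat -> {RV P >-> R})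
    (c : R) (a : nat -> R) (n : nat) (v : R) :
  sigma_of_sequence X (exceedance P X c a n v).
Proof.
suff : measurable (exceedance P X c a n v :
    set (sigma_of_sequence_type _ _ _ _ X)) by [].
apply: (@exists_lt_measurable _ _ (sigma_of_sequence_type _ _ _ _ X)
  (fun k w => \sum_(j < k.+1) (X j w - c) * a j)) => k.
apply: measurable_sum => j; apply: measurable_funM => //.
by apply: measurable_funB => //; exact: sequence_measurable.
Qed.

(** * Tails of the common loss distribution *)

Section tails.
Context {R : realType} {d : measure_display} {T : measurableType d}.
Variables (P : probability T R) (X : nat -> {RV P >-> R}) (F : R -> R).
Local Notation pr A := (fine (P A)).
Hypothesis X_law : forall n x, cdf (X n) x = (F x)%:E.

Lemma pr_gt n x : pr [set w | x < X n w] = 1 - F x.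
Proof.
have -> : P [set w | x < X n w] = ccdf (X n) x.
  by rewrite /ccdf /distribution /pushforward preimage_itvoy.
by rewrite ccdf_1_cdf X_law.
Qed.

Lemma pr_gt_pair i j x y : mutually_independent X -> (i < j)%N ->
  pr ([set w | x < X i w] `&` [set w | y < X j w]) = (1 - F x) * (1 - F y).
Proof.
move=> X_indep ij.
(* Only the indices [i] and [j] are evaluated, so a single test separates the two half-lines. *)
pose B k : set R := if k == i then `]x, +oo[%classic else `]y, +oo[%classic.
have ji : (j == i) = false by rewrite gtn_eqF.
have := X_indep [fset i; j]%fset B; rewrite big_fsetU1 ?inE /= ?big_seq_fset1;
  last by rewrite ltn_eqF.
rewrite /B eqxx ji !preimage_itvoy !pr_gt => <-; last by move=> k; case: ifP.
congr (pr _); apply/seteqP; split => w /=.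
  move=> [wi wj] k /=; rewrite !inE => /orP[] /eqP ->.
    by rewrite eqxx /= in_itv /= wi.
  by rewrite ji /= in_itv /= wj.
move=> h; have := h i; have := h j; rewrite /= !inE !eqxx orbT ji /= !in_itv /= !andbT.
by move=> -> // ->.
Qed.

Lemma tail_cvg0 : 1 - F x @[x --> +oo] --> (0 : R).
Proof.
rewrite (_ : (fun x => 1 - F x) = fine \o ccdf (X 0%N)).
  by apply: fine_cvg; exact: cvg_ccdfy0.
by apply/funext => x /=; rewrite ccdf_1_cdf X_law.
Qed.

End tails.

(** * Asymptotics of the ruin probability *)

Theorem theorem3 (R : realType) (d : measure_display) (T : measurableType d)
    (P : probability T R)
    (Z I : nat -> {RV P >-> R})
    (W : R -> R) (mu : R)
    (l : nat) (i_ : 'I_l -> R) (p : 'M[R]_l)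
    (b theta eta alpha : R)
    (Z_ge0 : forall n w, 0 <= Z n.+1 w)
    (Z_indep : mutually_independent (fun n => Z n.+1))
    (Z_law : forall n x, cdf (Z n.+1) x = (W x)%:E)
    (Z_mean : ('E_P[Z 1%N] = mu%:E)%E)
    (i_inj : injective i_)
    (I_markov : markov_chain i_ p I)
    (I0_gt0 : forall s, (0 < P [set w | I 0%N w = i_ s])%E)
    (ZI_indep : independent_sequences (fun n => Z n.+1) I)
    (b_gt0 : 0 < b) (b_le1 : b <= 1)
    (theta_gt0 : 0 < theta) (eta_ge : theta <= eta)
    (net_profit : b * mu < premium theta eta mu b)
    (V : R -> R)
    (V_law : forall x, cdf (b *: (Z 1%N : {mfun T >-> R}) : {RV P >-> R}) x = (V x)%:E)
    (alpha_gt0 : 0 < alpha)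
    (W_rv : regularly_varying alpha W)
    (I_gtN1 : forall n w, 0 < 1 + I n w)
    (moment : forall s,
      (0 < cond_expectation P (fun w => ((1 + I 1%N w) `^ (- alpha))%R)
             [set w | I 0%N w = i_ s] < +oo)%E) :
  forall (s : 'I_l) (n : nat), (1 <= n)%N ->
    ruin_prob Z I b (premium theta eta mu b) n u (i_ s) /
      (ruin_const I alpha n (i_ s) * (1 - V u)) @[u --> +oo] --> (1 : R).
Proof.
move=> s n n0.
have i0 t := state_gtN1 P l i_ I I0_gt0 t I_gtN1.
set c := premium theta eta mu b.
have mu_ge0 : 0 <= mu.
  by rewrite -lee_fin -Z_mean expectation_ge0.
(* By the net profit condition the premium exceeds [b * mu], which is nonnegative. *)
have c_ge0 : 0 <= c / b.
  rewrite divr_ge0 ?ltW // (le_lt_trans _ net_profit) // mulr_ge0 //.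
  exact: ltW.
pose X k := Z k.+1.
pose G x := 1 - W x.
have VE u : 1 - V u = G (u / b).
  rewrite /G; congr (1 - _); apply/EFin_inj; rewrite -V_law -(Z_law 0%N).
  congr (P _); apply/seteqP; split => w /=; rewrite !in_itv /= ler_pdivlMr //.
    by rewrite mulrC.
  by rewrite mulrC.
have p_ge0 := transition_ge0 P l i_ p I I_markov I0_gt0.
have p_sum1 := transition_sum1 P l i_ p I i_inj I_markov I0_gt0.
have rcE := ruin_constE P l i_ p I i_inj I_markov I0_gt0 alpha n s I_gtN1.
have coef_gt0 : 0 < ruin_const I alpha n (i_ s) by rewrite rcE ruin_coef_gt0.
pose a := discount (fun t => 1 + i_ t) s.
pose E q u := exceedance P X (c / b) (a q) (size q) (u / b).
(* Average over the paths of length [n]; the probability of the initial state cancels in the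
   conditioning. *)
have ruinE u : ruin_prob Z I b c n u (i_ s) =
    sum_paths n (fun q => path_weight p s q * fine (P (E q u))).
  set B := [set w | exists2 k, (1 <= k <= n)%N & surplus Z I b c u k w < 0].
  have mB : measurable B.
    have -> : B = [set w | exists2 k, (k < n)%N & 0 < - surplus Z I b c u k.+1 w].
      apply/seteqP; split => w /= [k kn].
        by move: k kn => [//|k] kn wk; exists k; rewrite ?oppr_gt0.
      by rewrite oppr_gt0 => wk; exists k.+1.
    apply: (exists_lt_measurable _ _ _ (fun k w => - surplus Z I b c u k.+1 w)) => k.
    by apply: measurable_funN; exact: surplus_measurable.
  rewrite /ruin_prob /cond_prob (pr_split_paths P l i_ p I i_inj I_markov n) //.
  rewrite mulrC -sum_pathsMl; apply: eq_sum_paths => q qn.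
  have -> : B `&` path_event P l i_ I s q = E q u `&` path_event P l i_ I s q.
    (* On the path event the rates are the listed states. The accumulated interest is positive, so
       the sign of the surplus is that of its discounted value. *)
    have key w k : path_event P l i_ I s q w -> (k < n)%N ->
        (surplus Z I b c u k.+1 w < 0) =
        (u / b < \sum_(j < k.+1) (X j w - c / b) * a q j).
      move=> wq kn; rewrite surplusE ?gt_eqF // => [|m w']; last by rewrite gt_eqF.
      rewrite pmulr_rlt0; last by apply: prodr_gt0.
      rewrite subr_lt0 ltr_pdivrMr // [in RHS]mulrC; congr (_ < b * _).
      apply: eq_bigr => j _; congr (_ / _); apply: eq_bigr => m _.
      by rewrite wq // qn (leq_trans (ltn_ord m)) // (leq_trans (ltn_ord j)).
    apply/seteqP; split => w [wB wq]; split => //.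
      case: wB => -[//|k] kn; rewrite key // => wk.
      by exists k => //; rewrite qn.
    case: wB => k; rewrite qn => kn wk.
    by exists k.+1 => //; rewrite key.
  (* With the discount factors frozen along [q], [E q u] depends on the losses alone and is
     independent of the path event. *)
  rewrite (ZI_indep _ _ (exceedance_sigma _ _ _ _ X _ _ _ _)
    (path_event_sigma _ _ _ _ _ _ I _ _)).
  rewrite fineM ?fin_num_measure //; last 2 first.
  - exact: exceedance_measurable.
  - exact: path_event_measurable.
  rewrite (pr_path_event P l i_ p I I_markov) [fine (P (E q u)) * _]mulrC -mulrA.
  by rewrite mulKf // gt_eqF // pr_I0_gt0.
(* Since [1 - V u = G (u / b)], this is the weighted-sum limit at the level [v = u / b]. *)
have cvg_path q : fine (P (E q u)) / (1 - V u) @[u --> +oo] -->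
    discount_sum (fun t => 1 + i_ t) alpha q.
  under eq_fun do rewrite VE.
  rewrite (discount_sumE _ _ i0 s).
  have uby : u / b @[u --> +oo] --> +oo by apply: gt0_cvgMly; rewrite ?invr_gt0.
  apply: (cvg_comp _ (fun v =>
    fine (P (exceedance P X (c / b) (a q) (size q) v)) / G v) uby).
  apply: exceedance_cvg => //.
  - exact: pr_gt.
  - by move=> i j x y ij; apply: pr_gt_pair.
  - exact: (tail_cvg0 P X).
  - by move=> j; exact: discount_gt0.
(* The sum over paths is finite, so the limit passes inside; the weighted average of [discount_sum]
   is the constant $c_n$. *)
have lim : sum_paths n (fun q => path_weight p s q * (fine (P (E q u)) / (1 - V u)))
    @[u --> +oo] --> ruin_const I alpha n (i_ s).
  rewrite rcE -(sum_path_weight_discount _ _ _ p_sum1).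
  apply: (cvg_sum_paths _ _ _ _ (fun u q =>
    path_weight p s q * (fine (P (E q u)) / (1 - V u)))).
  by move=> q _; apply: cvgMr.
have -> : (fun u => ruin_prob Z I b c n u (i_ s) /
      (ruin_const I alpha n (i_ s) * (1 - V u))) =
    (fun u => sum_paths n (fun q =>
      path_weight p s q * (fine (P (E q u)) / (1 - V u))) /
      ruin_const I alpha n (i_ s)).
  apply/funext => u; rewrite ruinE invfM mulrA mulrAC; congr (_ / _).
  rewrite mulrC -sum_pathsMl; apply: eq_sum_paths => q _.
  by rewrite mulrCA [X in _ * X]mulrC.
have h := cvgM lim (cvg_cst (ruin_const I alpha n (i_ s))^-1).
by rewrite divff ?lt0r_neq0 // in h; exact: h.
Qed.
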